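(* Let $G=(X,Y;E)$ be a finite simple bipartite graph with parts $X,Y$ where $|X|=m\ge n=|Y|$. If the minimum degree satisfies $$\delta(G)\ \ge\ \min\left\{n,\left\lfloor\frac{m+n}{3}\right\rfloor+1\right\},$$ then $G$ has positive Lin--Lu--Yau curvature, i.e. $\kappa_{\mathrm{LLY}}(x,y)>0$ for every edge $xy\in E$.
   Context: All graphs are finite and simple. Let $\rho$ denote graph distance and $d_x$ the degree of a vertex $x$. For probability measures $\mu_1,\mu_2$ on $V(G)$, the $L^1$-Wasserstein distance is $W(\mu_1,\mu_2)=\inf_\pi\sum_{u,v\in V}\rho(u,v)\pi(u,v)$, the infimum over $\pi:V\times V\to[0,1]$ with $\sum_v\pi(u,v)=\mu_1(u)$ for all $u$ and $\sum_u\pi(u,v)=\mu_2(v)$ for all $v$. For $\alpha\in[0,1]$ and a vertex $x$, $\mu_x^\alpha$ is the measure with $\mu_x^\alpha(x)=\alpha$, $\mu_x^\alpha(z)=\frac{1-\alpha}{d_x}$ if $z$ is adjacent to $x$, and $0$ otherwise. For an edge $xy$ (so $\rho(x,y)=1$), $\kappa_\alpha(x,y)=1-W(\mu_x^\alpha,\mu_y^\alpha)$ and the Lin--Lu--Yau curvature is $\kappa_{\mathrm{LLY}}(x,y)=\lim_{\alpha\to1^-}\frac{\kappa_\alpha(x,y)}{1-\alpha}$. (For edges, all the measures involved are supported in one connected component.) *)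

(* Defs.v *)
From HB Require Import structures.
From mathcomp Require Import all_boot all_order all_algebra.
From mathcomp Require Import all_classical all_reals all_analysis.

Set Implicit Arguments.
Unset Strict Implicit.
Unset Printing Implicit Defensive.

Import Order.TTheory GRing.Theory Num.Theory.
Import numFieldNormedType.Exports.

Local Open Scope classical_set_scope.
Local Open Scope ring_scope.

Section Graph.
Variable T : finType.

Definition simple_graph (e : rel T) : Prop := symmetric e /\ irreflexive e.

Definition bipartition (e : rel T) (X Y : {set T}) : Prop :=
  [/\ X :&: Y = finset.set0,
      X :|: Y = [set: T]%SET
    & forall u v, e u v ->
        (u \in X) && (v \in Y) || (u \in Y) && (v \in X)].

Definition deg (e : rel T) (x : T) : nat := #|[set z | e x z]%SET|.

(* Degrees never exceed #|T|, so the default #|T| only matters when T is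
   empty. *)
Definition min_deg (e : rel T) : nat := \big[minn/#|T|]_(x : T) deg e x.

(* Least length of a walk from x to y. Distances are smaller than #|T| within
   a component; the value is #|T|, standing for infinity, across components.
   A coupling of two measures carried by one component gives those pairs no
   mass. *)
Definition gdist (e : rel T) (x y : T) : nat :=
  find (fun k => [exists p : k.-tuple T, path e x p && (last x p == y)])
       (iota 0 #|T|).

End Graph.

Section Curvature.
Variables (R : realType) (T : finType).

Definition coupling (mu nu : T -> R) (p : T -> T -> R) : Prop :=
  [/\ forall u v, 0 <= p u v <= 1,
      forall u, \sum_(v : T) p u v = mu u
    & forall v, \sum_(u : T) p u v = nu v].

Definition transport_cost (e : rel T) (p : T -> T -> R) : R :=
  \sum_(u : T) \sum_(v : T) (gdist e u v)%:R * p u v.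

Definition wasserstein (e : rel T) (mu nu : T -> R) : R :=
  inf [set transport_cost e p | p in coupling mu nu].

Definition lazy_measure (e : rel T) (a : R) (x : T) : T -> R :=
  fun z => if z == x then a else if e x z then (1 - a) / (deg e x)%:R else 0.

Definition kappa (e : rel T) (a : R) (x y : T) : R :=
  1 - wasserstein e (lazy_measure e a x) (lazy_measure e a y).

Definition kappa_ratio (e : rel T) (x y : T) (a : R) : R :=
  kappa e a x y / (1 - a).

Definition kappa_LLY (e : rel T) (x y : T) : R :=
  lim (kappa_ratio e x y a @[a --> 1^'-]).

(* [lim] is a total operator, so that the limit exists is stated explicitly. *)
Definition positive_LLY (e : rel T) : Prop :=
  forall x y, e x y ->
    cvg (kappa_ratio e x y a @[a --> 1^'-]) /\ 0 < kappa_LLY e x y.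

End Curvature.

(* Main.v *)
Require Import Defs.
From HB Require Import structures.
From mathcomp Require Import all_boot all_order all_algebra.
From mathcomp Require Import perm.
From mathcomp Require Import all_classical all_reals all_analysis.
From mathcomp Require Import zify ring lra.

(** If [u], [v] are non-adjacent vertices of different parts, then
    [m + n < 3 * delta]. For an edge [xy], put [deg e y] copies of each
    neighbour of [x] on one side and [deg e x] copies of each neighbour of [y]
    on the other. The degree bound says that non-adjacent copies have degrees
    adding up to more than the size of a side, so exchanging two values of a
    permutation with the most edges gives a perfect matching; one can moreover
    keep a copy of [y] matched with a copy of [x]. At laziness
    [c = 1 / (deg e x * deg e y + 1)] every copy carries mass [c], and the
    matched pair [(y, x)] together with the two lazy masses can be left in
    place; all other mass moves along edges, so the Wasserstein distance is
    below 1. Mixing couplings shows that the curvature ratio is nondecreasing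
    in the laziness, hence its limit exists and is positive. *)

Section LinLuYau.
Set Implicit Arguments.
Unset Strict Implicit.
Import Order.TTheory GRing.Theory Num.Theory.
Import numFieldNormedType.Exports.
Local Open Scope classical_set_scope.
Local Open Scope ring_scope.

(** * Perfect matchings under an Ore-type condition *)

Lemma perm_of_ore (S : finType) (r : rel S) (i0 : S) :
  r i0 i0 ->
  (forall i j, ~~ r i j ->
     (#|S| < #|[set k | r i k]%SET| + #|[set k | r k j]%SET|)%N) ->
  exists s : {perm S}, s i0 = i0 /\ forall i, r i (s i).
Proof.
move=> r0 ore.
pose good (s : {perm S}) := [set i | r i (s i)]%SET.
have fix1 : (1%g : {perm S}) i0 == i0 by rewrite perm1.
case: (arg_maxnP (P := fun s : {perm S} => s i0 == i0)
  (fun s => #|good s|) fix1) => s /eqP s0 smax.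
exists s; split=> // i; apply/negPn/negP => bad_i.
have ni0 : i != i0 by apply: contraNneq bad_i => ->; rewrite s0.
(* Swapping the values of [s] at [i] and at an index of [A :&: B] would repair [i]. Neither set
   contains the bad index [i], so the union has at most [#|S| - 1] elements and the intersection at
   least two. *)
pose A := [set k | r i (s k)]%SET; pose B := [set k | r k (s i)]%SET.
have cA : #|A| = #|[set k | r i k]%SET|.
  rewrite -[RHS](on_card_preimset (onW_bij _ (Bijective (permK s) (permKV s)))).
  by apply: eq_card => k; rewrite !inE.
have iAB : A :|: B \subset [set~ i]%SET.
  apply/fintype.subsetP=> k; rewrite !inE; apply: contraTneq => ->.
  by rewrite (negbTE bad_i).
have := ore _ _ bad_i; rewrite -cA -/B => lt_S.
have lt1 : (1 < #|A :&: B|)%N.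
  have := cardsUI A B; have := subset_leq_card iAB; rewrite cardsC1.
  have : (0 < #|S|)%N by apply/card_gt0P; exists i.
  lia.
(* The strict inequality gives two candidates [k], so one is not [i0]. *)
have [k kAB nk0] : exists2 k, k \in A :&: B & k != i0.
  have [k kP] : exists k, k \in (A :&: B) :\ i0.
    apply/card_gt0P; move: lt1; rewrite (cardsD1 i0); case: (i0 \in _) => /=; lia.
  by exists k; move: kP; rewrite !inE => /andP[].
move: kAB; rewrite !inE => /andP[rik rki].
have nik : i != k by apply: contraNneq bad_i => e1; rewrite {2}e1.
pose s' := (tperm i k * s)%g.
have s'0 : s' i0 == i0 by rewrite permM tpermD // s0.
have /= := smax s' s'0; apply/negP; rewrite -ltnNge.
apply: proper_card; apply/properP; split.
  apply/fintype.subsetP=> j; rewrite !inE permM.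
  by case: tpermP => [->|->|]//; rewrite (negbTE bad_i).
by exists i; rewrite !inE ?permM ?tpermL.
Qed.

(** * Degrees and graph distance *)

Lemma min_deg_le (T : finType) (e : rel T) (z : T) : (min_deg e <= deg e z)%N.
Proof.
rewrite /min_deg; have := mem_index_enum z; elim: (index_enum T) => // u l IH.
rewrite in_cons big_cons geq_min => /predU1P[<-|/IH ->]; first by rewrite leqnn.
by rewrite orbT.
Qed.

Lemma gdist_refl (T : finType) (e : rel T) (u : T) : gdist e u u = 0%N.
Proof.
rewrite /gdist; case cT: #|T| => [|k] /=; first by move: (fintype0 u cT).
by rewrite ifT //; apply/fintype.existsP; exists [tuple] => /=.
Qed.

Lemma gdist_gt0 (T : finType) (e : rel T) (u v : T) :
  u != v -> (0 < gdist e u v)%N.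
Proof.
move=> nuv; rewrite /gdist; case cT: #|T| => [|k] /=.
  by move: (fintype0 u cT).
by case: ifP => // /fintype.existsP[p]; rewrite tuple0 /= (negbTE nuv).
Qed.

Lemma gdist_le1 (T : finType) (e : rel T) (u v : T) :
  e u v -> (gdist e u v <= 1)%N.
Proof.
move=> euv; case: (eqVneq u v) => [->|nuv]; first by rewrite gdist_refl.
(* [gdist] searches lengths below [#|T|], so length 1 must be in range. *)
have : (1 < #|T|)%N.
  by have := max_card [set u; v]%SET; rewrite cards2 nuv.
rewrite /gdist; case: #|T| => [|[|k]] //= _.
case: ifP => // _; rewrite ifT //; apply/fintype.existsP.
by exists [tuple v]; rewrite /= euv /= eqxx.
Qed.

(** * Couplings, transport cost and lazy measures *)

Section Transport.
Variables (R : realType) (T : finType) (e : rel T).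
Implicit Types (mu nu : T -> R) (p : T -> T -> R).

Lemma coupling_of_marginals mu nu p :
  (forall u v, 0 <= p u v) -> (forall u, mu u <= 1) ->
  (forall u, \sum_v p u v = mu u) -> (forall v, \sum_u p u v = nu v) ->
  coupling mu nu p.
Proof.
move=> p0 mu1 row col; split=> // u v; rewrite p0 /=.
apply: le_trans (mu1 u); rewrite -row (bigD1 v) //= lerDl.
by apply: sumr_ge0 => w _.
Qed.

Lemma coupling_le_l mu nu p u v : coupling mu nu p -> p u v <= mu u.
Proof.
case=> p01 row _; rewrite -row (bigD1 v) //= lerDl.
by apply: sumr_ge0 => w _; case/andP: (p01 u w).
Qed.

Lemma coupling_le_r mu nu p u v : coupling mu nu p -> p u v <= nu v.
Proof.
case=> p01 _ col; rewrite -col (bigD1 u) //= lerDl.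
by apply: sumr_ge0 => w _; case/andP: (p01 w v).
Qed.

Lemma coupling_product mu nu :
  (forall u, 0 <= mu u) -> (forall u, 0 <= nu u) ->
  \sum_u mu u = 1 -> \sum_u nu u = 1 ->
  coupling mu nu (fun u v => mu u * nu v).
Proof.
move=> mu0 nu0 mu1 nu1; apply: coupling_of_marginals.
- by move=> u v; exact: mulr_ge0.
- by move=> u; rewrite -mu1 (bigD1 u) //= lerDl sumr_ge0.
- by move=> u; rewrite -mulr_sumr nu1 mulr1.
- by move=> v; rewrite -mulr_suml mu1 mul1r.
Qed.

Lemma transport_cost_ge0 mu nu p :
  coupling mu nu p -> 0 <= transport_cost e p.
Proof.
case=> p01 _ _; apply: sumr_ge0 => u _; apply: sumr_ge0 => v _.
by rewrite mulr_ge0 //; case/andP: (p01 u v).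
Qed.

Lemma wasserstein_le mu nu p :
  coupling mu nu p -> wasserstein e mu nu <= transport_cost e p.
Proof.
move=> cp; apply: ge_inf; last by exists p.
by exists 0 => _ [q cq <-]; exact: transport_cost_ge0 cq.
Qed.

(** Having a coupling excludes the default value of an infimum over the empty set. *)
Lemma wasserstein_ge mu nu (c : R) :
  (exists p, coupling mu nu p) ->
  (forall p, coupling mu nu p -> c <= transport_cost e p) ->
  c <= wasserstein e mu nu.
Proof.
move=> [p cp] lbc; apply: lb_le_inf; first by exists (transport_cost e p), p.
by move=> _ [q cq <-]; exact: lbc.
Qed.

(** All mass off the diagonal travels a distance of at least 1. *)
Lemma transport_cost_ge_diag mu nu p :
  \sum_u mu u = 1 -> coupling mu nu p ->
  1 - \sum_u p u u <= transport_cost e p.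
Proof.
move=> mu1 [p01 row _]; rewrite -mu1 -sumrB; apply: ler_sum => u _.
rewrite -row (bigD1 u) //= addrAC subrr add0r [leRHS](bigD1 u) //=.
rewrite gdist_refl mul0r add0r.
apply: ler_sum => v nvu; rewrite ler_peMl //; first by case/andP: (p01 u v).
by rewrite ler1n gdist_gt0 // eq_sym.
Qed.

(** Each entry of [r] carries mass [c] from its first to its second component, repetitions adding
    up. *)
Definition atomic_plan (c : R) (r : seq (T * T)) (u v : T) : R :=
  c * \sum_(i <- r) (i == (u, v))%:R.

Lemma atomic_plan_row c r u :
  \sum_v atomic_plan c r u v = c * \sum_(i <- r) (i.1 == u)%:R.
Proof.
rewrite -mulr_sumr exchange_big /=; congr (_ * _); apply: eq_bigr => -[a b] _.
rewrite (bigD1 b) //= big1 ?addr0 => [|v nvb].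
  by rewrite xpair_eqE eqxx andbT.
by rewrite xpair_eqE [b == v]eq_sym (negbTE nvb) andbF.
Qed.

Lemma atomic_plan_col c r v :
  \sum_u atomic_plan c r u v = c * \sum_(i <- r) (i.2 == v)%:R.
Proof.
rewrite -mulr_sumr exchange_big /=; congr (_ * _); apply: eq_bigr => -[a b] _.
rewrite (bigD1 a) //= big1 ?addr0 => [|u nua].
  by rewrite xpair_eqE eqxx.
by rewrite xpair_eqE [a == u]eq_sym (negbTE nua).
Qed.

Lemma transport_cost_atomic c r :
  transport_cost e (atomic_plan c r) =
  c * \sum_(i <- r) (gdist e i.1 i.2)%:R.
Proof.
rewrite /transport_cost /atomic_plan.
under eq_bigr do under eq_bigr do rewrite mulrCA mulr_sumr.
rewrite pair_bigA /= -mulr_sumr exchange_big /=; congr (_ * _).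
apply: eq_bigr => -[a b] _; rewrite (bigD1 (a, b)) //= big1 ?addr0.
  by rewrite eqxx mulr1.
by move=> [u v] nuv /=; rewrite eq_sym (negbTE nuv) mulr0.
Qed.

(** The two supports are disjoint by irreflexivity. In this form the measure is visibly affine in
    [a]. *)
Lemma lazy_measureE (a : R) (x z : T) : irreflexive e ->
  lazy_measure e a x z =
  a * (x == z)%:R + (1 - a) / (deg e x)%:R * (e x z)%:R.
Proof.
move=> irr; rewrite /lazy_measure [z == x]eq_sym.
case: eqVneq => [<-|_]; first by rewrite irr mulr1 mulr0 addr0.
by case: (e x z); rewrite ?mulr0 ?mulr1 ?add0r ?addr0.
Qed.

Lemma lazy_measure_ge0 (a : R) (x z : T) :
  0 <= a <= 1 -> 0 <= lazy_measure e a x z.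
Proof.
move=> /andP[a0 a1]; rewrite /lazy_measure; case: ifP => // _; case: ifP => // _.
by rewrite divr_ge0 // subr_ge0.
Qed.

Lemma lazy_measure_sum (a : R) (x y : T) :
  irreflexive e -> e x y -> \sum_z lazy_measure e a x z = 1.
Proof.
move=> irr exy; under eq_bigr do rewrite lazy_measureE //.
rewrite big_split /= -!mulr_sumr (bigD1 x) //= eqxx big1 ?addr0 => [|z].
  rewrite -natr_sum -big_mkcond sum1dep_card -/(deg e x) mulr1 divfK ?subrKC //.
  by rewrite pnatr_eq0 -lt0n; apply/card_gt0P; exists y; rewrite inE.
by rewrite eq_sym => /negbTE ->.
Qed.

Lemma lazy_measure_le (a : R) (x z : T) :
  0 <= a <= 1 -> x != z -> lazy_measure e a x z <= 1 - a.
Proof.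
move=> /andP[a0 a1] nxz; rewrite /lazy_measure eq_sym (negbTE nxz).
have a1' : 0 <= 1 - a by rewrite subr_ge0.
case: ifP => // exz; rewrite ler_pdivrMr ?ler_peMr ?ler1n ?ltr0n //.
all: by apply/card_gt0P; exists z; rewrite inE.
Qed.

End Transport.

(** * Monotonicity and limit of the curvature ratio *)

Section Curvature.
Variables (R : realType) (T : finType) (e : rel T) (x y : T).
Hypotheses (sym_e : symmetric e) (irr_e : irreflexive e) (exy : e x y).

Let nxy : x != y.
Proof. by apply: contraTneq exy => ->; rewrite irr_e. Qed.

Lemma lazy_coupling_exists (a : R) : 0 <= a <= 1 ->
  exists p, coupling (lazy_measure e a x) (lazy_measure e a y) p.
Proof.
move=> a01; eexists; apply: coupling_product.
- by move=> u; exact: lazy_measure_ge0.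
- by move=> u; exact: lazy_measure_ge0.
- exact: lazy_measure_sum exy.
- by apply: (@lazy_measure_sum _ _ _ _ _ x) => //; rewrite sym_e.
Qed.

(** With [t = (1 - b) / (1 - a)], the measure at [b] is [t] times the one at [a] plus [1 - t] times
    a point mass. Moving the point mass along the edge costs at most [1 - t], so the distances
    satisfy [W_b <= t * W_a + (1 - t)]. *)
Lemma kappa_ratio_homo (a b : R) : 0 <= a -> a <= b -> b < 1 ->
  kappa_ratio e x y a <= kappa_ratio e x y b.
Proof.
move=> a0 ab b1; have a1 : a < 1 by exact: le_lt_trans b1.
have a1' : 0 < 1 - a by rewrite subr_gt0.
have b1' : 0 < 1 - b by rewrite subr_gt0.
pose t := (1 - b) / (1 - a).
have t0 : 0 < t by exact: divr_gt0.
have t1 : t <= 1 by rewrite ler_pdivrMr // mul1r lerD2l lerN2.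
have ta : t * (1 - a) = 1 - b by rewrite /t divfK // gt_eqF.
suff le_W : (wasserstein e (lazy_measure e b x) (lazy_measure e b y) - (1 - t))
    / t <= wasserstein e (lazy_measure e a x) (lazy_measure e a y).
  rewrite /kappa_ratio /kappa ler_pdivrMr // mulrAC ler_pdivlMr // -ta.
  move: le_W; rewrite ler_pdivrMr // => le_W; nra.
apply: wasserstein_ge; first by apply: lazy_coupling_exists; rewrite a0 ltW.
move=> p cp; rewrite ler_pdivrMr // lerBlDr.
pose q u v := t * p u v + (1 - t) * atomic_plan 1 [:: (x, y)] u v.
have convex z w : lazy_measure e b z w =
    t * lazy_measure e a z w + (1 - t) * (z == w)%:R.
  rewrite !lazy_measureE // -ta; have -> : b = 1 - t * (1 - a) by rewrite ta; lra.
  ring.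
have [p01 row col] := cp.
have cq : coupling (lazy_measure e b x) (lazy_measure e b y) q.
  apply: coupling_of_marginals => [u v|u|u|v].
  - apply: addr_ge0; apply: mulr_ge0; rewrite ?(ltW t0) ?subr_ge0 //.
      by case/andP: (p01 u v).
    by rewrite /atomic_plan mul1r sumr_ge0.
  - rewrite -(lazy_measure_sum b irr_e exy) (bigD1 u) //= lerDl.
    by apply: sumr_ge0 => w _; apply: lazy_measure_ge0;
      rewrite (ltW b1) (le_trans a0).
  - rewrite big_split /= -2!mulr_sumr row atomic_plan_row big_seq1 mul1r.
    by rewrite convex.
  - rewrite big_split /= -2!mulr_sumr col atomic_plan_col big_seq1 mul1r.
    by rewrite convex.
apply: (le_trans (wasserstein_le e cq)).
have -> : transport_cost e q = t * transport_cost e p +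
    (1 - t) * transport_cost e (atomic_plan 1 [:: (x, y)]).
  rewrite /transport_cost !mulr_sumr -big_split; apply: eq_bigr => u _ /=.
  rewrite !mulr_sumr -big_split; apply: eq_bigr => v _ /=; rewrite /q; ring.
rewrite transport_cost_atomic big_seq1 mul1r /= mulrC lerD2l.
by rewrite ler_piMr ?subr_ge0 // lern1 gdist_le1.
Qed.

(** Each vertex [u] differs from [x] or from [y], so a coupling has [p u u <= 1 - a] and leaves at
    most [#|T| * (1 - a)] in place. This crude bound is enough for convergence. *)
Lemma kappa_ratio_le (a : R) : 0 <= a -> a < 1 -> kappa_ratio e x y a <= #|T|%:R.
Proof.
move=> a0 a1; have a1' : 0 < 1 - a by rewrite subr_gt0.
have a01 : 0 <= a <= 1 by rewrite a0 ltW.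
rewrite /kappa_ratio /kappa ler_pdivrMr // lerBlDr -lerBlDl.
apply: wasserstein_ge; first exact: lazy_coupling_exists.
move=> p cp; apply: (le_trans _ (transport_cost_ge_diag e _ cp)); last first.
  exact: lazy_measure_sum exy.
rewrite lerD2l lerN2 mulr_natl.
have <- : \sum_(u : T) (1 - a) = (1 - a) *+ #|T| by rewrite sumr_const.
apply: ler_sum => u _.
case: (eqVneq x u) => [<-|nxu].
  apply: (le_trans (coupling_le_r _ _ cp)).
  by apply: lazy_measure_le; rewrite // eq_sym.
apply: (le_trans (coupling_le_l _ _ cp)); exact: lazy_measure_le.
Qed.

(** A monotone bounded ratio has a limit no smaller than its value at [c], so one laziness with
    positive [kappa] is enough. *)
Lemma kappa_LLY_gt0 (c : R) : 0 <= c -> c < 1 -> 0 < kappa e c x y ->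
  cvg (@kappa_ratio R T e x y a @[a --> 1^'-]) /\ 0 < @kappa_LLY R T e x y.
Proof.
move=> c0 c1 kc.
have rc : 0 < kappa_ratio e x y c by rewrite divr_gt0 // subr_gt0.
have near0 : \forall b \near (1 : R)^'-, 0 <= b by exact: nbhs_left_ge ltr01.
have cv : cvg (@kappa_ratio R T e x y a @[a --> 1^'-]).
  apply: nondecreasing_at_left_is_cvgr.
    apply: filterS near0 => b b0 s t.
    rewrite !in_itv /= => /andP[bs s1] /andP[bt t1] st.
    by apply: kappa_ratio_homo => //; rewrite (le_trans b0) ?ltW.
  apply: filterS near0 => b b0; exists #|T|%:R => z [s /=].
  rewrite in_itv /= => /andP[bs s1] <-.
  by apply: kappa_ratio_le => //; rewrite (le_trans b0) ?ltW.
split=> //; apply: (lt_le_trans rc); apply: limr_ge => //.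
near=> b; apply: kappa_ratio_homo => //; near: b; exact: nbhs_left_ge.
Unshelve. all: by end_near.
Qed.

End Curvature.

(** * Counting with repeated neighbours *)

Lemma sum_enum_val_fst (T : finType) (A B : {set T}) (F : T -> nat) :
  (\sum_(s : 'I_#|A| * 'I_#|B|) F (enum_val s.1) =
   #|B| * \sum_(u in A) F u)%N.
Proof.
rewrite -(pair_bigA _ (fun i j => F (enum_val i))) exchange_big /=.
by rewrite sum_nat_const card_ord [in RHS]big_enum_val.
Qed.

Lemma sum_enum_val_snd (T : finType) (A B : {set T}) (F : T -> nat) :
  (\sum_(s : 'I_#|A| * 'I_#|B|) F (enum_val s.2) =
   #|A| * \sum_(v in B) F v)%N.
Proof.
rewrite -(pair_bigA _ (fun i j => F (enum_val j))) /=.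
by rewrite sum_nat_const card_ord [in RHS]big_enum_val.
Qed.

Lemma sum_in_set_eq (T : finType) (A : {set T}) (u : T) :
  (\sum_(z in A) (z == u) = (u \in A))%N.
Proof.
rewrite big_mkcond (bigD1 u) //= eqxx big1 ?addn0 => [|z /negbTE ->].
  by case: (u \in A).
by case: ifP.
Qed.

Lemma sum_in_set_bool (T : finType) (A : {set T}) (P : pred T) :
  (\sum_(z in A) P z = #|[set z | P z] :&: A|)%N.
Proof.
rewrite -sum1_card big_mkcond [RHS]big_mkcond; apply: eq_bigr => z _.
by rewrite !inE andbC; case: (z \in A); case: (P z).
Qed.

(** * Positive curvature from a matching of copies *)

Section PositiveCurvature.
Variables (R : realType) (T : finType) (e : rel T) (x y : T).
Hypotheses (sym_e : symmetric e) (irr_e : irreflexive e) (exy : e x y).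

Let Nx := [set z | e x z]%SET.
Let Ny := [set z | e y z]%SET.
(** One index type serves both sides: [f] repeats each neighbour of [x] [deg e y] times, [g] each
    neighbour of [y] [deg e x] times, so a perfect matching is a permutation of [S]. *)
Let S : finType := ('I_#|Nx| * 'I_#|Ny|)%type.
Let f (s : S) : T := enum_val s.1.
Let g (s : S) : T := enum_val s.2.

Let sum_row (u : T) : \sum_s (f s == u)%:R = (deg e y)%:R * (e x u)%:R :> R.
Proof.
rewrite -natr_sum (sum_enum_val_fst Nx Ny (fun z => z == u)).
by rewrite sum_in_set_eq inE natrM.
Qed.

Let sum_col (v : T) : \sum_s (g s == v)%:R = (deg e x)%:R * (e y v)%:R :> R.
Proof.
rewrite -natr_sum (sum_enum_val_snd Nx Ny (fun z => z == v)).
by rewrite sum_in_set_eq inE natrM.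
Qed.

Lemma LLY_gt0_of_matching (s0 : S) (s : {perm S}) :
  f s0 = y -> g s0 = x -> s s0 = s0 -> (forall i, e (f i) (g (s i))) ->
  cvg (@kappa_ratio R T e x y a @[a --> 1^'-]) /\ 0 < @kappa_LLY R T e x y.
Proof.
move=> f0 g0 ss0 es.
have dx : (0 < deg e x)%N by apply/card_gt0P; exists y; rewrite inE.
have dy : (0 < deg e y)%N by apply/card_gt0P; exists x; rewrite inE sym_e.
pose N : R := (deg e x * deg e y)%:R.
have N0 : 0 < N by rewrite ltr0n muln_gt0 dx.
(* Chosen so that [1 - c = c * N]: a neighbour of [x] then has mass [c * deg e y], which is [c] per
   copy and matches the lazy mass [c]. *)
pose c : R := (N + 1)^-1.
have cN : c * (N + 1) = 1 by rewrite mulVf // gt_eqF // addr_gt0.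
have c0 : 0 < c by rewrite invr_gt0 addr_gt0.
have c1 : c < 1 by rewrite invf_lt1 ?ltrDr ?addr_gt0.
apply: (@kappa_LLY_gt0 _ _ _ _ _ _ _ _ c) => //; first exact: ltW.
(* The matching [s] together with the lazy masses would send [x] to [y] and,
   at [s0], [y] to [x]; leaving both masses in place saves a cost of 2. *)
pose r := [:: (x, x), (y, y) & [seq (f i, g (s i)) | i <- index_enum S & i != s0]].
have sum_r (F : T * T -> R) :
    \sum_(i <- r) F i = F (x, x) + F (y, y) + \sum_(i | i != s0) F (f i, g (s i)).
  by rewrite !big_cons big_map big_filter addrA.
have d0x : (deg e x)%:R != 0 :> R by rewrite pnatr_eq0 -lt0n.
have d0y : (deg e y)%:R != 0 :> R by rewrite pnatr_eq0 -lt0n.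
have c1N : 1 - c = c * ((deg e x)%:R * (deg e y)%:R).
  by rewrite -[X in X - _]cN /N natrM; ring.
have row u : \sum_v atomic_plan c r u v = lazy_measure e c x u.
  rewrite atomic_plan_row sum_r /= lazy_measureE // -addrA.
  (* In the rows [(y, y)] replaces the omitted index [s0], as [f s0 = y]; in the columns [(x, x)]
     does, as [g (s s0) = x]. *)
  have -> : (y == u)%:R + \sum_(i | i != s0) (f i == u)%:R =
      \sum_i (f i == u)%:R :> R by rewrite [RHS](bigD1 s0) //= f0.
  by rewrite sum_row c1N; field.
have col v : \sum_u atomic_plan c r u v = lazy_measure e c y v.
  rewrite atomic_plan_col sum_r /= lazy_measureE // addrAC.
  have -> : (x == v)%:R + \sum_(i | i != s0) (g (s i) == v)%:R =
      \sum_i (g i == v)%:R :> R.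
    by rewrite [RHS](reindex_inj (@perm_inj _ s)) [RHS](bigD1 s0) //= ss0 g0.
  by rewrite sum_col c1N; field.
have cp : coupling (lazy_measure e c x) (lazy_measure e c y) (atomic_plan c r).
  apply: coupling_of_marginals => // [u v|u].
    by rewrite mulr_ge0 ?(ltW c0) // sumr_ge0.
  rewrite -(lazy_measure_sum c irr_e exy) (bigD1 u) //= lerDl.
  by apply: sumr_ge0 => w _; apply: lazy_measure_ge0; rewrite !ltW.
rewrite subr_gt0; apply: (le_lt_trans (wasserstein_le e cp)).
rewrite transport_cost_atomic sum_r /= !gdist_refl !add0r -[ltRHS]cN ltr_pM2l //.
(* Even with [s0] counted again there are [N] unit costs, still below [N + 1]. *)
apply: (@le_lt_trans _ _ (\sum_(i : S) 1)).
  rewrite big_mkcond; apply: ler_sum => i _; case: ifP => // _.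
  by rewrite lern1 gdist_le1.
by rewrite sumr_const card_prod !card_ord ltrDl.
Qed.

Lemma LLY_gt0_of_degrees (P Q : {set T}) (d : nat) :
  (forall u v, e u v -> u \in P -> v \in Q) ->
  (forall u v, e u v -> u \in Q -> v \in P) ->
  x \in P -> (forall z, d <= deg e z)%N ->
  (forall u v, u \in Q -> v \in P -> ~~ e u v -> #|P| + #|Q| < 3 * d)%N ->
  cvg (@kappa_ratio R T e x y a @[a --> 1^'-]) /\ 0 < @kappa_LLY R T e x y.
Proof.
move=> ePQ eQP xP d_le nonadj.
have yQ : y \in Q by exact: ePQ xP.
have yNx : y \in Nx by rewrite inE.
have xNy : x \in Ny by rewrite inE sym_e.
have ef i : e x (f i) by have := enum_valP i.1; rewrite inE.
have eg i : e y (g i) by have := enum_valP i.2; rewrite inE.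
pose s0 : S := (enum_rank_in yNx y, enum_rank_in xNy x).
have f0 : f s0 = y by rewrite /f enum_rankK_in.
have g0 : g s0 = x by rewrite /g enum_rankK_in.
have e0 : e (f s0) (g s0) by rewrite f0 g0 sym_e.
have common (B : {set T}) (u v : T) : (forall z, e u z || e v z -> z \in B) ->
    (deg e u + deg e v <= #|B| + #|[set z | e u z] :&: [set z | e v z]|)%N.
  move=> uvB; rewrite /deg -[leqLHS]cardsUI leq_add2r.
  apply/subset_leq_card/fintype.subsetP.
  by move=> z; rewrite !inE => /uvB.
have [s [ss0 es]] : exists s : {perm S}, s s0 = s0 /\ forall i, e (f i) (g (s i)).
  apply: (@perm_of_ore _ (fun i j => e (f i) (g j))) => // i j nij.
  have fQ : f i \in Q by exact: ePQ (ef i) xP.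
  have gP : g j \in P by exact: eQP (eg j) yQ.
  have lt3d := nonadj _ _ fQ gP nij.
  have cP : (deg e (f i) + deg e y <=
      #|P| + #|[set z | e (f i) z]%SET :&: Ny|)%N.
    by apply: common => z /orP[/eQP|/eQP]; apply.
  have cQ : (deg e (g j) + deg e x <=
      #|Q| + #|[set z | e (g j) z]%SET :&: Nx|)%N.
    by apply: common => z /orP[/ePQ|/ePQ]; apply.
  rewrite card_prod !card_ord.
  (* Every [g k] adjacent to [f i] is a common neighbour of [f i] and [y], and each of these occurs
     [deg e x] times. *)
  have -> : #|[set k | e (f i) (g k)]%SET| =
      (deg e x * #|[set z | e (f i) z]%SET :&: Ny|)%N.
    rewrite -sum1dep_card big_mkcond.
    by rewrite (sum_enum_val_snd Nx Ny (e (f i))) sum_in_set_bool.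
  have -> : #|[set k | e (f k) (g j)]%SET| =
      (deg e y * #|[set z | e (g j) z]%SET :&: Nx|)%N.
    rewrite -sum1dep_card big_mkcond; under eq_bigr do rewrite sym_e.
    by rewrite (sum_enum_val_fst Nx Ny (e (g j))) sum_in_set_bool.
  have := d_le (f i); have := d_le (g j); have := d_le x; have := d_le y.
  have yP : (deg e y <= #|P|)%N.
    by apply/subset_leq_card/fintype.subsetP => z; rewrite inE => /eQP; apply.
  have xQ : (deg e x <= #|Q|)%N.
    by apply/subset_leq_card/fintype.subsetP => z; rewrite inE => /ePQ; apply.
  rewrite -/(deg e x) -/(deg e y).
  (* Let [a], [b] be the degrees of [x], [y], and [p = #|P| - d], [q = #|Q| - d]. These are
     nonnegative since [d <= b <= #|P|] and [d <= a <= #|Q|], and [p + q < d]. The copy degrees add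
     up to at least [a * (b - p) + b * (a - q)], and [a * p + b * q <= max(a, b) * (p + q) < max(a,
     b) * d <= a * b]. *)
  nia.
exact: LLY_gt0_of_matching f0 g0 ss0 es.
Qed.

End PositiveCurvature.
End LinLuYau.

(** * Using the minimum degree condition *)

Theorem theorem1p1 (R : realType) (T : finType) (e : rel T)
    (X Y : {set T}) (m n : nat)
    (simple_e : simple_graph e) (bip_e : bipartition e X Y)
    (cardX : #|X| = m) (cardY : #|Y| = n) (le_nm : (n <= m)%N)
    (min_deg_e : (minn n ((m + n) %/ 3).+1 <= min_deg e)%N) :
  positive_LLY R e.
Proof.
have [sym_e irr_e] := simple_e; have [XY0 _ bip] := bip_e.
have nXY z : z \in X -> z \in Y = false.
  by move=> zX; apply/negP => zY; have := finset.in_set0 z; rewrite -XY0 inE zX zY.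
have eXY u v : e u v -> u \in X -> v \in Y.
  by move=> /bip /orP[/andP[]//|/andP[uY _] /nXY]; rewrite uY.
have eYX u v : e u v -> u \in Y -> v \in X.
  by move=> /bip /orP[/andP[uX _]|/andP[]//]; rewrite (nXY _ uX).
have nonadj u v : u \in X -> v \in Y -> ~~ e u v -> (m + n < 3 * min_deg e)%N.
  (* As [u] misses [v], its degree is below [n]; so the minimum in the hypothesis is not [n], and
     [min_deg e] exceeds the floor of [(m + n) / 3]. *)
  move=> uX vY nuv; suff : (deg e u < n)%N by have := min_deg_le e u; lia.
  rewrite -cardY; apply/proper_card/properP; split; last first.
    by exists v => //; rewrite inE.
  by apply/fintype.subsetP => z; rewrite inE => /eXY; apply.
move=> x y exy; have /orP[/andP[xX yY]|/andP[xY yX]] := bip _ _ exy.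
  apply: (@LLY_gt0_of_degrees _ _ _ _ _ _ _ _ X Y (min_deg e)) => //.
    exact: min_deg_le.
  by move=> u v uY vX; rewrite sym_e cardX cardY; exact: nonadj.
apply: (@LLY_gt0_of_degrees _ _ _ _ _ _ _ _ Y X (min_deg e)) => //.
  exact: min_deg_le.
by move=> u v uX vY; rewrite addnC cardX cardY; exact: nonadj.
Qed.
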